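(* Let $R$ be a finite Frobenius ring, let $m\ge1$, and let $C$ be a left (or right) $R$-linear code of length $n$. For each $f\in\mathrm{Harm}_d(n)$, $$Z^{[m]}_{C,f}(x,y)=(-1)^d\sum_{\substack{X\subseteq E,\\ d\le|X|\le n-d}}\widetilde f(X)\,(|R|^m)^{\alpha_C(E)-\alpha_C(X)}\,(x-y)^{|X|-d}\,y^{|E-X|-d}.$$
   Context: Let $E=\{1,\dots,n\}$, let $0\le d\le n$, and let $E_d$ be the set of $d$-element subsets of $E$. $\mathbb{R}E_d$ is the real vector space with basis $E_d$; its elements $f=\sum_{Z\in E_d}f(Z)Z$ are identified with functions $E_d\to\mathbb{R}$. The linear map $\gamma$ on $\mathbb{R}E_d$ is given by $\gamma(Z)=\sum_{Y\in E_{d-1},\,Y\subseteq Z}Y$ for $Z\in E_d$ (and $\gamma=0$ if $d=0$), and $\mathrm{Harm}_d(n)=\ker(\gamma|_{\mathbb{R}E_d})$. For $f\in\mathbb{R}E_d$ and $X\subseteq E$ put $\widetilde f(X)=\sum_{Z\in E_d,\,Z\subseteq X}f(Z)$. Rings are associative with identity, and $R$ is nonzero. A finite ring $R$ is Frobenius if $R/\mathrm{Rad}(R)\cong\mathrm{Soc}(R_R)$ as right $R$-modules and $R/\mathrm{Rad}(R)\cong\mathrm{Soc}({}_RR)$ as left $R$-modules, where $\mathrm{Rad}$ is the Jacobson radical and $\mathrm{Soc}$ the socle. A left (right) $R$-linear code of length $n$ is a left (right) $R$-submodule of $R^n$. The support of $\mathbf{u}\in R^n$ is $\mathrm{supp}(\mathbf{u})=\{i\in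 E: u_i\ne 0\}$. For $Y\subseteq E$, the punctured code $C\backslash Y$ is obtained by deleting the coordinates in $Y$ from every codeword of $C$. Define $\alpha_C(X)=\log_{|R|}|C\backslash(E-X)|$ for $X\subseteq E$. For $X\subseteq E$, let $A^{[m]}_C(X)$ be the number of $(\mathbf{u}_1,\dots,\mathbf{u}_m)\in C^m$ with $\mathrm{supp}(\mathbf{u}_1)\cup\dots\cup\mathrm{supp}(\mathbf{u}_m)=X$. The $m$-tuple harmonic weight enumerator of $C$ associated to $f\in\mathrm{Harm}_d(n)$ is $W^{[m]}_{C,f}(x,y)=\sum_{X\subseteq E}\widetilde f(X)A^{[m]}_C(X)x^{|E-X|}y^{|X|}$. It is known that $\widetilde f(X)=0$ when $|X|<d$ or $|X|>n-d$, and $Z^{[m]}_{C,f}$ denotes the polynomial with $W^{[m]}_{C,f}(x,y)=(xy)^dZ^{[m]}_{C,f}(x,y)$, i.e. $$Z^{[m]}_{C,f}(x,y)=\sum_{\substack{X\subseteq E,\\ d\le|X|\le n-d}}\widetilde f(X)A^{[m]}_C(X)x^{|E-X|-d}y^{|X|-d}.$$ *)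

(* Defs.v *)
From HB Require Import structures.
From mathcomp Require Import all_boot all_order all_algebra.
From mathcomp Require Import all_classical all_reals all_analysis.

Set Implicit Arguments.
Unset Strict Implicit.
Unset Printing Implicit Defensive.

Import Order.TTheory GRing.Theory Num.Theory.

Local Open Scope ring_scope.
Local Open Scope quotient_scope.

Notation dsubset n d := {Z : {set 'I_n} | #|Z| == d}.
Notation dspace K n d := {ffun dsubset n d -> K^o}.

Definition dbasis (K : realType) (n d : nat) (Y : dsubset n d) : dspace K n d :=
  [ffun Z => (Z == Y)%:R].

(* The target is indexed by d.-1, so for d = 0 it is the space of 0-subsets
   again; the guard makes gamma vanish there. *)
Definition gamma (K : realType) (n d : nat) (f : dspace K n d) :
    dspace K n d.-1 :=
  if d == 0%N then 0
  else \sum_(Z : dsubset n d)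
         f Z *: (\sum_(Y : dsubset n d.-1 | val Y \subset val Z) dbasis K Y).

Definition harm (K : realType) (n d : nat) (f : dspace K n d) : Prop :=
  gamma f = 0.

Definition tilde (K : realType) (n d : nat) (f : dspace K n d)
    (X : {set 'I_n}) : K :=
  \sum_(Z : dsubset n d | val Z \subset X) f Z.

Section Frobenius.
Variable R : finNzRingType.
Implicit Types I M : {set R}.

Definition left_ideal I : bool :=
  [&& 0 \in I, [forall x in I, forall y in I, x + y \in I]
    & [forall r, forall x in I, r * x \in I]].

Definition right_ideal I : bool :=
  [&& 0 \in I, [forall x in I, forall y in I, x + y \in I]
    & [forall r, forall x in I, x * r \in I]].

Definition maximal_left_ideal M : bool :=
  maxset (fun I => left_ideal I && (I != [set: R])) M.

Definition minimal_left_ideal M : bool :=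
  minset (fun I => left_ideal I && (I != [set 0])) M.

Definition minimal_right_ideal M : bool :=
  minset (fun I => right_ideal I && (I != [set 0])) M.

Definition jacobson : {set R} := \bigcap_(M | maximal_left_ideal M) M.

Definition family_sum (P : pred {set R}) : {set R} :=
  [set x | [exists g : {ffun {set R} -> R},
     [forall I, P I ==> (g I \in I)] && (x == \sum_(I | P I) g I)]].

Definition left_socle : {set R} := family_sum minimal_left_ideal.
Definition right_socle : {set R} := family_sum minimal_right_ideal.

Definition jacobson_pred : {pred R} := [pred x | x \in jacobson].

Lemma jacobson_zmod_closed : zmod_closed jacobson_pred.
Proof.
split=> [|x y]; rewrite !inE.
  by apply/bigcapP => M /maxsetp /andP[/and3P[]].
move=> /bigcapP xJ /bigcapP yJ; apply/bigcapP => M maxM.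
have /andP[/and3P[_ MD MZ] _] := maxsetp maxM.
have yM : - y \in M.
  by rewrite -mulN1r; apply: (forall_inP (forallP MZ (-1))); exact: yJ.
by apply: (forall_inP (forall_inP MD x _)) => //; exact: xJ.
Qed.

HB.instance Definition _ :=
  GRing.isZmodClosed.Build R jacobson_pred jacobson_zmod_closed.

End Frobenius.

Definition rad_quotient (R : finNzRingType) : zmodType :=
  Quotient.quot (@jacobson_pred R).

Definition radproj (R : finNzRingType) (x : R) : rad_quotient R :=
  \pi_(Quotient.quot (@jacobson_pred R)) x.

(* The R-actions on R / Rad(R) are [x] r = [x r] and r [x] = [r x], where
   [x] = radproj x; an isomorphism onto the socle is given as an injective
   module morphism to R whose image is the socle. *)
Definition frobenius (R : finNzRingType) : Prop :=
  (exists phi : {additive rad_quotient R -> R},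
     [/\ injective phi,
         (forall s : R, s \in right_socle R <-> exists q, phi q = s)
       & forall x r : R, phi (radproj (x * r)) = phi (radproj x) * r])
  /\
  (exists phi : {additive rad_quotient R -> R},
     [/\ injective phi,
         (forall s : R, s \in left_socle R <-> exists q, phi q = s)
       & forall r x : R, phi (radproj (r * x)) = r * phi (radproj x)]).

Section Codes.
Variables (R : finNzRingType) (n : nat).
Implicit Types (u v : 'rV[R]_n) (C : {set 'rV[R]_n}) (X Y : {set 'I_n}).

Definition left_linear C : Prop :=
  [/\ 0 \in C, (forall u v, u \in C -> v \in C -> u + v \in C)
    & forall (r : R) u, u \in C -> (\row_i (r * u 0 i)) \in C].

Definition right_linear C : Prop :=
  [/\ 0 \in C, (forall u v, u \in C -> v \in C -> u + v \in C)
    & forall (r : R) u, u \in C -> (\row_i (u 0 i * r)) \in C].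

Definition supp u : {set 'I_n} := [set i | u 0 i != 0].

Definition delete_coords Y u : 'rV[R]_#|~: Y| :=
  \row_(j < #|~: Y|) u 0 (enum_val j).

Definition puncture C Y : {set 'rV[R]_#|~: Y|} :=
  [set delete_coords Y u | u in C].

Definition alpha (K : realType) C X : K :=
  ln (#|puncture C (~: X)|%:R) / ln (#|R|%:R).

Definition tuple_support_count (m : nat) C X : nat :=
  #|[set u : {ffun 'I_m -> 'rV[R]_n} |
      [forall i, u i \in C] && (\bigcup_(i < m) supp (u i) == X)]|.

End Codes.

(* Polynomials in x, y are elements of {poly {poly K}}: x is the outer
   variable 'X and y is 'Y, that is 'X%:P (notation of polyXY). *)
Definition Zpoly (K : realType) (R : finNzRingType) (n d m : nat)
    (C : {set 'rV[R]_n}) (f : dspace K n d) : {poly {poly K}} :=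
  \sum_(X : {set 'I_n} | (d <= #|X| <= n - d)%N)
    ((tilde f X * (tuple_support_count m C X)%:R)%:P)%:P
      * 'X ^+ (#|~: X| - d) * 'Y ^+ (#|X| - d).

(* Main.v *)
Require Import Defs.
From HB Require Import structures.
From mathcomp Require Import all_boot all_order all_algebra.
From mathcomp Require Import zify ring.
From mathcomp Require Import all_classical all_reals all_analysis.

(** Why the identity holds.

    Encode f as the homogeneous multilinear polynomial
    P(w) = sum_Z f(Z) prod_(i in Z) w_i, so that tilde f (X) is the value of P
    at the indicator vector of X.  The condition gamma f = 0 says that the sum
    of the partial derivatives of P vanishes, so P is invariant under
    translation by constant vectors ([set_polynomial_shift]).  Both properties
    of harmonic functions that matter come from one such translation:
    - moving the indicator of the complement of X by -1 gives
      tilde f (~: X) = (-1)^d tilde f (X) ([mass_setC]);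
    - moving the vector equal to a + b on Y and to b off Y by -b makes its
      value a^d tilde f (Y), which evaluates
      sum_(X containing Y) tilde f (X) a^|~: X| b^|X| ([sum_mass_supersets]).

    On the coding side, the m-tuples of codewords whose joint support lies in X
    are the m-tuples from the subcode C_X of words supported in X, so
    sum_(Y included in X) A(Y) = |C_X|^m ([sum_tuple_support_count]).  Since C_X
    is the kernel of the puncturing map that deletes X, |C_X| is
    |C| / |C \ X| ([card_puncture_shortened]), which is |R| to the power
    alpha(E) - alpha(E - X) ([powR_alpha]).

    With a = x - y and b = y, exchanging the sums over Y included in X turns
    sum_X tilde f (X) |C_X|^m a^|~: X| b^|X| into (a b)^d Z(x, y), and
    complementing X turns it into (a b)^d times the right-hand side; a b is
    nonzero in an integral domain and cancels ([harmonic_transform]). *)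

Set Implicit Arguments.
Unset Strict Implicit.
Unset Printing Implicit Defensive.

Import Order.TTheory GRing.Theory Num.Theory.

Local Open Scope ring_scope.

(** * Expansions of products over sets *)

Lemma prodrD_in (L : comNzRingType) (I : finType) (Z : {set I}) (F G : I -> L) :
  \prod_(i in Z) (F i + G i) =
  \sum_(S : {set I} | S \subset Z) (\prod_(i in S) F i) * \prod_(i in Z :\: S) G i.
Proof.
rewrite big_mkcond (eq_bigr (fun i =>
  (if i \in Z then F i else 0) + (if i \in Z then G i else 1))); last first.
  by move=> i _; case: ifP; rewrite ?add0r.
rewrite bigA_distr [RHS]big_mkcond; apply: eq_bigr => S _.
case: ifP => [sSZ | /negbT/subsetPn[i iS iZ]]; last first.
  by rewrite (bigD1 i)//= iS (negbTE iZ) mul0r.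
rewrite [X in _ = X * _]big_mkcond [X in _ = _ * X]big_mkcond -big_split.
apply: eq_bigr => i _ /=; rewrite finset.in_setD.
by case: (boolP (i \in S)) => iS /=; rewrite ?(fintype.subsetP sSZ _ iS) ?mulr1 ?mul1r.
Qed.

(** The sum is the expansion of the product over all i of b + a_i, where a_i is
    0 on V and a off V: choosing b at i means putting i in X. *)
Lemma sum_supersets (L : comNzRingType) (I : finType) (V : {set I}) (a b : L) :
  \sum_(X : {set I} | V \subset X) a ^+ #|~: X| * b ^+ #|X| =
  b ^+ #|V| * (a + b) ^+ #|~: V|.
Proof.
rewrite -!prodr_const [X in _ = X * _]big_mkcond [X in _ = _ * X]big_mkcond.
rewrite -big_split (eq_bigr (fun i => b + (if i \in V then 0 else a))); last first.
  move=> i _ /=; rewrite finset.in_setC.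
  by case: ifP; rewrite ?addr0 ?mulr1 ?mul1r // addrC.
rewrite bigA_distr [LHS]big_mkcond; apply: eq_bigr => X _.
case: ifP => [sVX | /negbT/subsetPn[i iV iX]]; last first.
  by rewrite (bigD1 i)//= iV (negbTE iX) mul0r.
rewrite -!prodr_const [X in X * _ = _]big_mkcond [X in _ * X = _]big_mkcond.
rewrite -big_split; apply: eq_bigr => i _ /=; rewrite finset.in_setC.
case: (boolP (i \in X)) => iX /=; rewrite ?mul1r ?mulr1 //.
by case: ifP => // /(fintype.subsetP sVX); rewrite (negbTE iX).
Qed.

(** * Harmonic functions as translation-invariant polynomials *)

(** In terms of P this says that all the coefficients of the powers of c in
    P(w + c) - P(w) vanish.  The coefficients are taken in an arbitrary ring so
    that real functions can be pushed to polynomials. *)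
Definition null_design (L : comNzRingType) n d (F : dsubset n d -> L) :=
  forall S : {set 'I_n}, (#|S| < d)%N ->
    \sum_(Z : dsubset n d | S \subset val Z) F Z = 0.

(** For |S| = d - 1 the sum is the coefficient of gamma f at S.  Smaller S follow
    by downward induction: adding up the vanishing sums for i |: S over the
    points i outside S counts each Z containing S exactly d - |S| times, a
    number that is invertible in K. *)
Lemma harm_sum_supersets (K : realType) n d (f : dspace K n d) :
  harm f -> null_design (f : dsubset n d -> K).
Proof.
rewrite /harm /gamma; case: (boolP (d == 0%N)) => [/eqP d0 _ S Sd|d0 fh];
  first by exfalso; rewrite d0 in Sd.
suff H k (S : {set 'I_n}) : (#|S| + k = d.-1)%N ->
    \sum_(Z : dsubset n d | S \subset val Z) (f Z : K) = 0.
  by move=> S Sd; apply: (H (d.-1 - #|S|)%N); rewrite subnKC // -ltnS prednK // lt0n.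
elim: k S => [|k IHk] S cS.
  have cS' : #|S| == d.-1 by rewrite -cS addn0.
  have /ffunP/(_ (exist _ S cS')) := fh.
  rewrite sum_ffunE ffunE => fS; rewrite -[RHS]fS big_mkcond.
  apply: eq_bigr => Z _; rewrite ffunE sum_ffunE.
  case: ifP => SZ.
    rewrite (bigD1 (exist _ S cS')) //= ffunE eqxx big1 ?addr0 => [|Y /andP[_ nY]].
      by rewrite /GRing.scale /= mulr1.
    by rewrite ffunE eq_sym (negbTE nY).
  rewrite big1 ?scaler0 // => Y YZ; rewrite ffunE; case: eqP => // eY.
  by rewrite -eY /= SZ in YZ.
have : \sum_(i | i \notin S) \sum_(Z : dsubset n d | (i |: S) \subset val Z) (f Z : K) = 0.
  by apply: big1 => i iS; apply: IHk; rewrite cardsU1 iS add1n addSnnS.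
rewrite (exchange_big_dep (fun Z : dsubset n d => S \subset val Z)) /=; last first.
  by move=> i Z _; exact: (fintype.subset_trans (finset.subsetU1 i S)).
rewrite (eq_bigr (fun Z => (f Z : K) *+ (d - #|S|))); last first.
  move=> Z SZ; rewrite sumr_const; congr (_ *+ _).
  rewrite -[in RHS](eqP (valP Z)) -cardsDS //; apply: eq_card => i.
  rewrite -[LHS]/((i \notin S) && (i |: S \subset sval Z)) finset.subUset.
  by rewrite finset.sub1set SZ andbT finset.in_setD.
rewrite sumrMnl => /eqP; rewrite mulrn_eq0 subn_eq0 => /orP[dS|/eqP //].
by exfalso; move: dS d0 cS; clear; case: d => //= e; lia.
Qed.

Section HarmonicPolynomial.
Variables (L : comNzRingType) (n d : nat) (F : dsubset n d -> L).
Implicit Types (X Y : {set 'I_n}) (w : 'I_n -> L).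

Definition set_polynomial w : L := \sum_Z F Z * \prod_(i in val Z) w i.

(** The function tilde F of the subsets of 'I_n, over a general ring. *)
Definition mass X : L := \sum_(Z : dsubset n d | val Z \subset X) F Z.

Lemma mass_small X : (#|X| < d)%N -> mass X = 0.
Proof.
move=> Xd; apply: big1 => Z /subset_leq_card; rewrite (eqP (valP Z)) leqNgt.
by rewrite Xd.
Qed.

Lemma set_polynomial_indicator (c : L) X :
  set_polynomial (fun i => if i \in X then c else 0) = c ^+ d * mass X.
Proof.
rewrite /mass mulr_sumr [RHS]big_mkcond; apply: eq_bigr => Z _.
case: ifP => [ZX | /negbT/subsetPn[i iZ iX]]; last first.
  by rewrite (bigD1 i) //= (negbTE iX) mul0r mulr0.
rewrite (eq_bigr (fun=> c)) => [|i /(fintype.subsetP ZX) -> //].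
by rewrite prodr_const (eqP (valP Z)) mulrC.
Qed.

Hypothesis harmF : null_design F.

(** The coefficient in P(w + c) of the monomial of S is c^(d - |S|) times the sum
    of F over the d-sets containing S; only the terms with |S| = d survive. *)
Lemma set_polynomial_shift w c :
  set_polynomial (fun i => w i + c) = set_polynomial w.
Proof.
rewrite /set_polynomial.
under eq_bigr => Z _.
  rewrite prodrD_in mulr_sumr (bigD1 (val Z)) //=.
  rewrite finset.setDv big_set0 mulr1.
  over.
rewrite big_split /= -[RHS]addr0; congr (_ + _).
rewrite (exchange_big_dep xpredT) //=; apply: big1 => S _.
pose G : L := (\prod_(i in S) w i) * c ^+ (d - #|S|).
rewrite (eq_bigr (fun Z => G * F Z)); last first.
  (* by homogeneity every Z containing S contributes the same power of c *)
  move=> Z /andP[SZ _].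
  by rewrite prodr_const cardsDS // (eqP (valP Z)) mulrC.
rewrite -mulr_sumr; case: (ltnP #|S| d) => Sd; last first.
  rewrite big_pred0 ?mulr0 // => Z; apply/negbTE/negP => /andP[SZ].
  by rewrite eqEcard SZ (eqP (valP Z)) Sd.
rewrite (eq_bigl (fun Z : dsubset n d => S \subset val Z)) => [|Z].
  by rewrite harmF ?mulr0.
case: (boolP (S \subset _)) => //= _; apply/eqP => eS.
by move: Sd; rewrite eS (eqP (valP Z)) ltnn.
Qed.

(** The indicator of ~: X minus the constant 1 is -1 times the indicator of X. *)
Lemma mass_setC X : mass (~: X) = (-1) ^+ d * mass X.
Proof.
have := set_polynomial_indicator 1 (~: X); rewrite expr1n mul1r => <-.
rewrite -set_polynomial_indicator -(set_polynomial_shift _ (-1)).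
congr set_polynomial; apply/funext => i; rewrite finset.in_setC.
by case: (i \in X) => /=; rewrite ?add0r ?subrr.
Qed.

(** The complement of X has fewer than d elements. *)
Lemma mass_large X : (n - d < #|X|)%N -> mass X = 0.
Proof.
move=> Xd; rewrite -[X]finset.setCK mass_setC mass_small ?mulr0 //.
by have := cardsC X; rewrite card_ord; have := max_card (mem X); rewrite card_ord; lia.
Qed.

Lemma card_setU_complement (Y Z : {set 'I_n}) : (#|Y| <= n - #|Z|)%N ->
  #|Z :|: Y| = (#|Y| + #|Z :\: Y|)%N /\
  #|~: (Z :|: Y)| = (n - #|Z| - #|Y| + #|Z :&: Y|)%N.
Proof.
move=> YZ; have := cardsUI Z Y; have := cardsC (Z :|: Y).
have := cardsID Y Z; have := max_card (mem Z); rewrite !card_ord.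
have -> : #|mem Z| = #|Z| by [].
by move: YZ; move: #|_| #|Y| #|_| #|_| #|_| #|_|; lia.
Qed.

(** Exchanging the sums over X and over the d-sets Z, the sum over X containing
    Y :|: Z gives b^|Y :|: Z| (a + b)^|~: (Y :|: Z)|.  Up to a factor that does
    not depend on Z, this is the product over Z of the weights a + b on Y and b
    off Y, so that translation by -b applies.  The bound on |Y| makes the
    exponent n - d - |Y| of that factor a true difference. *)
Lemma sum_mass_supersets Y (a b : L) : (#|Y| <= n - d)%N ->
  \sum_(X : {set 'I_n} | Y \subset X) mass X * (a ^+ #|~: X| * b ^+ #|X|) =
  mass Y * (a ^+ d * b ^+ #|Y| * (a + b) ^+ (n - d - #|Y|)).
Proof.
move=> Yd.
under eq_bigr => X _ do rewrite mulr_suml.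
rewrite (exchange_big_dep xpredT) //=.
under eq_bigr => Z _.
  rewrite -mulr_sumr.
  under eq_bigl => X do rewrite andbC -finset.subUset.
  rewrite sum_supersets.
  over.
transitivity (b ^+ #|Y| * (a + b) ^+ (n - d - #|Y|) *
  set_polynomial (fun i => (if i \in Y then a else 0) + b)).
  rewrite mulr_sumr; apply: eq_bigr => Z _; rewrite [RHS]mulrCA; congr (_ * _).
  rewrite (big_setID Y) /= [X in _ = _ * (X * _)](eq_bigr (fun=> a + b)); last first.
    by move=> i; rewrite inE => /andP[_ ->].
  rewrite [X in _ = _ * (_ * X)](eq_bigr (fun=> b)); last first.
    by move=> i; rewrite inE => /andP[/negbTE -> _]; rewrite add0r.
  have Yd' : (#|Y| <= n - #|val Z|)%N by rewrite (eqP (valP Z)).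
  have [/= -> ->] := card_setU_complement Yd'; rewrite (eqP (valP Z)).
  by rewrite !prodr_const !exprD; ring.
by rewrite set_polynomial_shift set_polynomial_indicator; ring.
Qed.

End HarmonicPolynomial.

(** Both sides, multiplied by (a b)^d, equal the full sum
    sum_X mass F X * (sum_(Y included in X) A Y) * a^|~: X| * b^|X|.  The
    left-hand side comes from [sum_mass_supersets] after exchanging the two sums,
    the right-hand side from the substitution X := ~: X. *)
Lemma harmonic_transform (L : idomainType) (n d : nat) (F : dsubset n d -> L)
    (A : {set 'I_n} -> L) (a b : L) :
  null_design F -> a != 0 -> b != 0 ->
  \sum_(Y : {set 'I_n} | (d <= #|Y| <= n - d)%N)
    mass F Y * A Y * (a + b) ^+ (#|~: Y| - d) * b ^+ (#|Y| - d) =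
  (-1) ^+ d * \sum_(X : {set 'I_n} | (d <= #|X| <= n - d)%N)
    mass F X * (\sum_(Y : {set 'I_n} | Y \subset ~: X) A Y) *
      a ^+ (#|X| - d) * b ^+ (#|~: X| - d).
Proof.
move=> harmF a0 b0.
have massF0 (X : {set 'I_n}) : ~~ (d <= #|X| <= n - d)%N -> mass F X = 0.
  rewrite negb_and -!ltnNge => /orP[]; [exact: mass_small | exact: mass_large].
have cC (X : {set 'I_n}) : (#|~: X| = n - #|X|)%N.
  by rewrite cardsCs finset.setCK card_ord.
have ab0 : a ^+ d * b ^+ d != 0 by rewrite mulf_neq0 ?expf_neq0.
apply: (mulIf ab0).
transitivity (\sum_(X : {set 'I_n}) mass F X * (\sum_(Y : {set 'I_n} | Y \subset X) A Y)
  * (a ^+ #|~: X| * b ^+ #|X|)).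
  rewrite mulr_suml.
  under [RHS]eq_bigr => X _ do rewrite mulr_sumr mulr_suml.
  rewrite (exchange_big_dep xpredT) //= big_mkcond; apply: eq_bigr => Y _.
  under [RHS]eq_bigr => X _ do rewrite mulrAC mulrC.
  rewrite -mulr_sumr; case: (leqP #|Y| (n - d)) => [Yd|Yd]; last first.
    rewrite andbF big1 ?mulr0 // => X /subset_leq_card YX.
    by rewrite (mass_large harmF) ?mul0r //; exact: leq_trans YX.
  (* for |Y| < d the sum over X vanishes through the factor mass F Y *)
  rewrite sum_mass_supersets // andbT; case: leqP => [dY|/mass_small ->].
    rewrite cC -[in b ^+ #|Y|](subnK dY) exprD.
    have -> : (n - #|Y| - d = n - d - #|Y|)%N by lia.
    ring.
  by rewrite mul0r mulr0.
rewrite -mulrA mulr_suml mulr_sumr (reindex_inj (@finset.setC_inj _)) /=.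
rewrite [RHS]big_mkcond; apply: eq_bigr => X _.
rewrite mass_setC //; case: ifP => [/andP[dX Xd]|/negbT/massF0 ->]; last first.
  by rewrite mulr0 !mul0r.
rewrite finset.setCK -[in a ^+ #|X|](subnK dX) exprD.
have dC : (d <= #|~: X|)%N by rewrite cC; move: dX Xd; move: #|X| => k; lia.
rewrite -[in b ^+ #|~: X|](subnK dC) exprD; ring.
Qed.

(** * Counting codewords by support *)

Section CodeCounts.
Variables (R : finNzRingType) (n : nat).
Implicit Types (u v : 'rV[R]_n) (C : {set 'rV[R]_n}) (X Y : {set 'I_n}).

Definition shortened C X : {set 'rV[R]_n} := [set u in C | supp u \subset X].

Lemma linear_zmod_closed C :
  left_linear C \/ right_linear C -> zmod_closed (mem C).
Proof.
have opp_closed D : (forall u v, u \in D -> v \in D -> u + v \in D) ->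
    (forall u, u \in D -> - u \in D) -> forall u v, u \in D -> v \in D -> u - v \in D.
  by move=> addD oppD u v uD vD; apply/addD/oppD.
case=> -[C0 addC mulC]; split=> //; apply: opp_closed => // u /(mulC (-1)).
  by congr (_ \in C); apply/rowP => i; rewrite !mxE mulN1r.
by congr (_ \in C); apply/rowP => i; rewrite !mxE mulrN1.
Qed.

Lemma delete_coords_eq Y u v :
  (delete_coords Y u == delete_coords Y v) = (supp (u - v) \subset Y).
Proof.
apply/eqP/idP => [/rowP uv|/fintype.subsetP uv].
  apply/fintype.subsetP => i; rewrite inE !mxE subr_eq0; apply: contraNT => iY.
  have iCY : i \in ~: Y by rewrite inE.
  by have := uv (enum_rank_in iCY i); rewrite !mxE enum_rankK_in // => ->.
apply/rowP => j; rewrite !mxE; apply/eqP; rewrite -subr_eq0.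
have := uv (enum_val j); rewrite inE !mxE; have := enum_valP j; rewrite inE.
by case: eqP => // _ /negbTE -> /(_ isT).
Qed.

(** Every fibre of the puncturing map over the code is a translate of its kernel,
    the subcode of the words supported in Y. *)
Lemma card_puncture_shortened C Y : zmod_closed (mem C) ->
  #|C| = (#|puncture C Y| * #|shortened C Y|)%N.
Proof.
case=> C0 subC; have oppC u : u \in C -> - u \in C.
  by move=> uC; rewrite -sub0r; exact: subC.
have addC u v : u \in C -> v \in C -> u + v \in C.
  by move=> uC vC; rewrite -[v]opprK; apply: subC => //; exact: oppC.
rewrite -sum1_card (partition_big (delete_coords Y) (mem (puncture C Y))) /=; last first.
  by move=> u uC; exact: imset_f.
rewrite -sum_nat_const; apply: eq_bigr => _ /imsetP[v vC ->].
rewrite sum1_card -(card_imset (shortened C Y) (addrI v)); apply: eq_card => u.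
rewrite unfold_in delete_coords_eq; apply/andP/imsetP => [[uC uv]|[w]].
  exists (u - v); last by rewrite addrC subrK.
  by rewrite inE uv andbT; exact: subC.
by rewrite inE => /andP[wC wY] ->; rewrite addrAC subrr add0r addC.
Qed.

(** A union of supports lies in X exactly when each support does. *)
Lemma sum_tuple_support_count m C X :
  (\sum_(Y : {set 'I_n} | Y \subset X) tuple_support_count m C Y =
   #|shortened C X| ^ m)%N.
Proof.
rewrite -[in RHS](card_ord m) -card_ffun_on -[RHS]sum1_card.
rewrite (partition_big (fun u : {ffun 'I_m -> 'rV[R]_n} => \bigcup_(i < m) supp (u i))
  (fun Y : {set 'I_n} => Y \subset X)) /=; last first.
  move=> u /ffun_onP uX; apply/finset.bigcupsP => i _.
  by have := uX i; rewrite inE => /andP[].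
apply: eq_bigr => Y YX; rewrite sum1_card /tuple_support_count.
apply: eq_card => u; rewrite !inE unfold_in /=.
apply/andP/andP => -[uC /eqP uY]; split; rewrite ?uY //.
  apply/ffun_onP => i; rewrite inE (forallP uC) (fintype.subset_trans _ YX) //.
  by rewrite -uY; exact: (finset.bigcup_sup i).
by apply/forallP => i; have /ffun_onP/(_ i) := uC; rewrite inE => /andP[].
Qed.

(** The kernel count applied to E and to X makes the exponent equal to
    ln |C_(~: X)| / ln |R|; a nontrivial ring has ln |R| nonzero. *)
Lemma powR_alpha (K : realType) m C X : zmod_closed (mem C) ->
  powR ((#|R| ^ m)%:R : K) (alpha K C [set: 'I_n] - alpha K C X) =
  (#|shortened C (~: X)| ^ m)%:R.
Proof.
move=> zC; have C0 : 0 \in C by case: zC.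
have R1 : (1 < #|R|)%N by rewrite (cardD1 0) (cardD1 1) !inE oner_eq0.
have lnR : ln (#|R|%:R : K) != 0 by rewrite gt_eqF // ln_gt0 // ltr1n.
have short0 Y : (0 < #|shortened C Y|)%N.
  apply/card_gt0P; exists 0; rewrite inE C0 /=.
  by apply/fintype.subsetP => i; rewrite inE mxE eqxx.
have punct0 Y : (0 < #|puncture C Y|)%N.
  by apply/card_gt0P; exists (delete_coords Y 0); exact: imset_f.
have cE : #|puncture C (~: [set: 'I_n])| = #|C|.
  (* no coordinate is deleted, so the kernel of the map is trivial *)
  rewrite (card_puncture_shortened (~: [set: 'I_n]) zC).
  suff -> : #|shortened C (~: [set: 'I_n])| = 1%N by rewrite muln1.
  apply/eqP/cards1P; exists 0; apply/setP => u; rewrite !inE.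
  rewrite finset.setCT finset.subset0; apply/andP/eqP => [[_ /eqP u0]|->].
    apply/rowP => i; apply/eqP; move/setP/(_ i): u0.
    by rewrite !inE mxE => /negbFE.
  by split=> //; apply/eqP/setP => i; rewrite !inE mxE eqxx.
rewrite /alpha cE (card_puncture_shortened (~: X) zC) -mulrBl natrM.
rewrite lnM ?posrE ?ltr0n // addrC addKr.
rewrite /powR gt_eqF ?ltr0n ?expn_gt0 ?(ltnW R1) // natrX lnXn ?ltr0n ?(ltnW R1) //.
rewrite -[_ *+ m]mulr_natl mulrCA divfK // expRM_natl lnK ?natrX //.
by rewrite posrE ltr0n.
Qed.

End CodeCounts.

(** * The harmonic weight enumerator *)

Theorem theorem3p2 (K : realType) (R : finNzRingType) (n d m : nat)
    (C : {set 'rV[R]_n}) (f : dspace K n d) :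
  (d <= n)%N ->
  frobenius R ->
  (1 <= m)%N ->
  left_linear C \/ right_linear C ->
  harm f ->
  Zpoly m C f =
    (-1) ^+ d *
    \sum_(X : {set 'I_n} | (d <= #|X| <= n - d)%N)
      ((tilde f X *
        powR ((#|R| ^ m)%:R : K) (alpha K C [set: 'I_n] - alpha K C X))%:P)%:P
      * ('X - 'Y) ^+ (#|X| - d) * 'Y ^+ (#|~: X| - d).
Proof.
move=> _ _ _ linC /harm_sum_supersets harmf.
have zC := linear_zmod_closed linC.
pose F (Z : dsubset n d) : {poly {poly K}} := ((f Z : K)%:P)%:P.
have harmF : null_design F.
  by move=> S /harmf fS; rewrite /F -!rmorph_sum /= fS !rmorph0.
have massF X : mass F X = ((tilde f X : K)%:P)%:P by rewrite /mass -!rmorph_sum.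
have Y0 : 'Y != 0 :> {poly {poly K}} by rewrite polyC_eq0 polyX_eq0.
have XY0 : 'X - 'Y != 0 :> {poly {poly K}} by rewrite polyXsubC_eq0.
have := harmonic_transform (fun Y => (tuple_support_count m C Y)%:R) harmF XY0 Y0.
rewrite subrK => E; transitivity ((-1) ^+ d * \sum_(X : {set 'I_n} | (d <= #|X| <= n - d)%N)
    mass F X * (\sum_(Y : {set 'I_n} | Y \subset ~: X) (tuple_support_count m C Y)%:R) *
      ('X - 'Y) ^+ (#|X| - d) * 'Y ^+ (#|~: X| - d)).
  rewrite -E; apply: eq_bigr => X _.
  by rewrite massF !rmorphM !rmorph_nat.
congr (_ * _); apply: eq_bigr => X _.
by rewrite powR_alpha // massF !rmorphM -natr_sum sum_tuple_support_count !rmorph_nat.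
Qed.
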